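(* Let $\mathcal C$ be the set of coalescing pairs of paths and let $\tilde d$ be the function on $\mathcal C\times\mathcal C$, both defined in the context. Then $\tilde d$ is a metric on $\mathcal C$, and $(\mathcal C,\tilde d)$ is a complete and separable metric space.
   Context: **Paths.** For $t_0\in[0,1]$ let $C[t_0]$ be the set of continuous functions $f:[t_0,\infty)\to\mathbb R$ with $f(t_0)\in[-1,1]$, and let $\Pi'=\bigcup_{t_0\in[0,1]}C[t_0]\times\{t_0\}$. An element is written $(f,t_0)$. For $(f,t_0)\in\Pi'$ let $\hat f(t)=f(t)$ for $t\ge t_0$ and $\hat f(t)=f(t_0)$ for $t\in[0,t_0]$. Define $$d'((f,t_0),(g,s_0))=|t_0-s_0|\vee\sum_{n\ge1}2^{-n}\Big(\sup_{t\in[0,n]}|\hat f(t)-\hat g(t)|\wedge1\Big).$$ **Coalescing pairs.** For $(f_1,t_1),(f_2,t_2)\in\Pi'$ let $t^+=t_1\vee t_2$ and $t^c=\inf\{t>t^+: f_1(t)=f_2(t)\}$ ($\inf\emptyset=\infty$). The two paths *coalesce* (are a coalescing pair) if either $t^c=\infty$ or $f_1(t)=f_2(t)$ for all $t\ge t^c$; $t^c$ is the coalescence time. $\mathcal C$ is the set of all (unordered) coalescing pairs of (possibly identical) elements of $\Pi'$. A pair is denoted $[(f_1,t_1),(f_2,t_2)]$, where the labelling is such that $f_1(t)\le f_2(t)$ for all $t\ge t^+$ (left path first); if $f_1=f_2$ on $[t^+,\infty)$ both labellings denote the same element. **The metric $\bar d$.** $\bar d([(f_1,t_1),(f_2,t_2)],[(g_1,s_1),(g_2,s_2)])$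 is the Hausdorff distance (with respect to $d'$) between $\{(f_1,t_1),(f_2,t_2)\}$ and $\{(g_1,s_1),(g_2,s_2)\}$, i.e. the maximum of $\max_i\min_j d'((f_i,t_i),(g_j,s_j))$ and $\max_j\min_i d'((f_i,t_i),(g_j,s_j))$, $i,j\in\{1,2\}$. **Pods.** Let $\Psi=\tanh$ with $\Psi(\infty)=1$. For $[(f_1,t_1),(f_2,t_2)]\in\mathcal C$ put $\tilde t^+=\Psi(t^+)$, $\tilde t^c=\Psi(t^c)$. If $t^+<t^c$, the pod is $\tilde p:[\tilde t^+,\tilde t^c)\to[0,\infty)$, $\tilde p(x)=f_2(\Psi^{-1}(x))-f_1(\Psi^{-1}(x))$, and if $t^c<\infty$ we set $\tilde p(\tilde t^c)=0$. If $t^+=t^c$, the pod is $\tilde p:\{\tilde t^+\}\to\{0\}$. Let $\tilde t^m$ be the midpoint of $[\tilde t^+,\tilde t^c]$. The standard pod $p$ is defined by $$p(x)=\begin{cases}\tilde p(x+\tilde t^+), & x\in[0,\tilde t^m-\tilde t^+],\\ \tilde p(x-(1-\tilde t^c)), & x\in[1-(\tilde t^c-\tilde t^m),1),\\ \tilde p(\tilde t^m)+\tfrac12[1-(\tilde t^c-\tilde t^+)], & x=1/2,\end{cases}$$ with $p(1)=0$ if $t^+=t^c$, and by linear interpolation on $[\tilde t^m-\tilde t^+,1/2]$ and on $[1/2,1-(\tilde t^c-\tilde t^m)]$ (so $p$ has slope $1$, respectively $-1$, there). Then $p$ is continuous and strictly positive on $(0,1)$. **The metric $\tilde d$.** For standard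 pods $p,q$ let $$\Delta(p,q)=\sum_{n\ge2}2^{-n}\Big(\sup_{x\in[\frac1n,1-\frac1n]}\Big|\frac1{p(x)}-\frac1{q(x)}\Big|\wedge1\Big),$$ and for two elements of $\mathcal C$ with standard pods $p,q$ respectively, define $$\tilde d([(f_1,t_1),(f_2,t_2)],[(g_1,s_1),(g_2,s_2)])=\bar d([(f_1,t_1),(f_2,t_2)],[(g_1,s_1),(g_2,s_2)])+\Delta(p,q).$$ *)

(* Defs.v *)
From HB Require Import structures.
From mathcomp Require Import all_boot all_order all_algebra.
From mathcomp Require Import all_classical all_reals all_analysis.
From mathcomp Require Import ring lra.

Set Implicit Arguments.
Unset Strict Implicit.
Unset Printing Implicit Defensive.

Import Order.TTheory GRing.Theory Num.Theory.
Import numFieldNormedType.Exports.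

Local Open Scope classical_set_scope.
Local Open Scope ring_scope.

Section metrics.
Context {R : realType} {T : Type}.

Record is_metric (d : T -> T -> R) : Prop := IsMetric {
  is_metric_ge0 : forall x y, 0 <= d x y;
  is_metric_xx : forall x, d x x = 0;
  is_metric_eq0 : forall x y, d x y = 0 -> x = y;
  is_metric_sym : forall x y, d x y = d y x;
  is_metric_triangle : forall y x z, d x z <= d x y + d y z }.

(* [metrized dm] is the type [T] carrying the metric [d], hence also the
   topology and the uniformity of [d]. *)
Definition metrized (d : T -> T -> R) (dm : is_metric d) : Type := T.

HB.instance Definition _ d (dm : is_metric d) :=
  gen_eqMixin (metrized dm).
HB.instance Definition _ d (dm : is_metric d) :=
  gen_choiceMixin (metrized dm).
HB.instance Definition _ d (dm : is_metric d) :=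
  isMetric.Build R (metrized dm)
    (is_metric_xx dm) (is_metric_eq0 dm) (is_metric_sym dm)
    (is_metric_triangle dm).

End metrics.

Definition complete_metric {R : realType} (M : metricType R) : Prop :=
  forall u : nat -> M, cauchy (u @ \oo) -> exists x : M, u @ \oo --> x.

Definition separable {T : topologicalType} : Prop :=
  exists2 D : set T, countable D & dense D.
Arguments separable T : clear implicits.

Section tanh.
Context {R : realType}.

Definition tanh (x : R) : R :=
  (expR x - expR (- x)) / (expR x + expR (- x)).

Definition artanh (y : R) : R := ln ((1 + y) / (1 - y)) / 2.

Lemma tanhK : cancel tanh artanh.
Proof.
move=> x; rewrite /artanh /tanh.
have p : 0 < expR x by exact: expR_gt0.
have q : 0 < expR (- x) by exact: expR_gt0.
have -> : (1 + (expR x - expR (- x)) / (expR x + expR (- x))) /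
          (1 - (expR x - expR (- x)) / (expR x + expR (- x))) =
          expR x / expR (- x).
  by field; rewrite !gt_eqF//; lra.
by rewrite expRN invrK -expRD expRK; lra.
Qed.

(* The value at [-oo] is never used. *)
Definition Psi (t : \bar R) : R :=
  match t with
  | r%:E => tanh r
  | +oo%E => 1
  | -oo%E => -1
  end.

End tanh.

(* An element (f, t0) of Pi'.  The function f, defined on [t0, +oo[, is stored
   as its extension to R that is constant on ]-oo, t0]; this makes equality of
   records coincide with equality of pairs (f, t0), and the stored function
   agrees on [0, +oo[ with \hat f. *)
Record rpath (R : realType) := RPath {
  start : R;
  pfun :> R -> R;
  start_itv : start \in `[0, 1];
  pfun_continuous : {within `[start, +oo[, continuous pfun};
  pfun_start : pfun start \in `[-1, 1];
  pfun_before : forall t, t <= start -> pfun t = pfun start }.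

Section coalescing_pairs.
Context {R : realType}.
Implicit Types f g : rpath R.

Definition dpath f g : R :=
  Num.max `|start f - start g|
    (\big[+%R/0]_(1 <= n <oo) (2^-1 ^+ n *
       Num.min (sup [set `|f t - g t| | t in `[0, n%:R]]) 1)).

Definition tplus f1 f2 : R := Num.max (start f1) (start f2).

Definition tcoal f1 f2 : \bar R :=
  ereal_inf [set t%:E | t in [set t | tplus f1 f2 < t /\ f1 t = f2 t]].

Definition coalesce f1 f2 : Prop :=
  tcoal f1 f2 = +oo%E \/
  (forall t : R, (tcoal f1 f2 <= t%:E)%E -> f1 t = f2 t).

(* Unordered pairs are subsets of the form [set f1; f2]. *)
Record cpair := CPair {
  cset : set (rpath R);
  csetP : exists f1 f2, cset = [set f1; f2] /\ coalesce f1 f2 }.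

Definition left_of f1 f2 : Prop :=
  forall t, tplus f1 f2 <= t -> f1 t <= f2 t.

Lemma coalesce_left_of f1 f2 :
  coalesce f1 f2 -> left_of f1 f2 \/ left_of f2 f1.
Proof.
move=> c12; have [|] := pselect (left_of f1 f2); first by left.
move=> /existsNP[s /not_implyP[ts /negP]]; rewrite -ltNge => s21; right.
rewrite /left_of /tplus maxC -/(tplus f1 f2) => t tt.
rewrite leNgt; apply/negP => t12.
have cont (a b : R) : tplus f1 f2 <= a ->
    {within `[a, b], continuous (fun x => f1 x - f2 x)}.
  move=> ta x; apply: continuousB.
  - apply: (continuous_subspaceW _ (@pfun_continuous _ f1)).
    move=> y /=; rewrite !in_itv/= andbT => /andP[+ _].
    by apply: le_trans; rewrite (le_trans _ ta)// le_max lexx.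
  - apply: (continuous_subspaceW _ (@pfun_continuous _ f2)).
    move=> y /=; rewrite !in_itv/= andbT => /andP[+ _].
    by apply: le_trans; rewrite (le_trans _ ta)// le_max lexx orbT.
have key (a b : R) : tplus f1 f2 <= a -> a <= b ->
    f1 a != f2 a -> f1 b != f2 b ->
    Num.min (f1 a - f2 a) (f1 b - f2 b) <= 0 <=
    Num.max (f1 a - f2 a) (f1 b - f2 b) -> False.
  move=> ta ab na nb /(IVT ab (cont a b ta))[c].
  rewrite in_itv/= => /andP[ac cb] /eqP; rewrite subr_eq0 => /eqP fc.
  have tc : (tcoal f1 f2 <= c%:E)%E.
    apply: ereal_inf_lbound; exists c => //; split => //.
    rewrite (le_lt_trans ta)// lt_neqAle ac andbT.
    by apply: contraNneq na => ->; rewrite fc.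
  case: c12 => [tE|/(_ b)]; first by move: tc; rewrite tE leye_eq.
  move=> fb; move/eqP: nb; apply; apply: fb.
  by rewrite (le_trans tc)// lee_fin.
have ns : f1 s != f2 s by rewrite gt_eqF.
have nt : f1 t != f2 t by rewrite lt_eqF.
case: (leP s t) => [st|/ltW st].
- apply: (key s t) => //.
  by rewrite ge_min le_max !subr_le0 !subr_ge0 (ltW s21) (ltW t12) !orbT.
- apply: (key t s) => //.
  by rewrite ge_min le_max !subr_le0 !subr_ge0 (ltW s21) (ltW t12) !orbT.
Qed.

Lemma labellingP (P : cpair) :
  exists f : rpath R * rpath R, cset P = [set f.1; f.2] /\ left_of f.1 f.2.
Proof.
have [f1 [f2 [-> /coalesce_left_of[fl|fl]]]] := csetP P.
- by exists (f1, f2).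
- by exists (f2, f1); rewrite setUC.
Qed.

(* If the two paths agree from [tplus] on, then both labellings are possible
   and [labelling] picks one of them; the pod does not depend on this choice. *)
Definition labelling (P : cpair) : rpath R * rpath R :=
  projT1 (cid (labellingP P)).
Definition left_path (P : cpair) : rpath R := (labelling P).1.
Definition right_path (P : cpair) : rpath R := (labelling P).2.

Definition dbar (P Q : cpair) : R :=
  let f1 := left_path P in let f2 := right_path P in
  let g1 := left_path Q in let g2 := right_path Q in
  Num.max
    (Num.max (Num.min (dpath f1 g1) (dpath f1 g2))
             (Num.min (dpath f2 g1) (dpath f2 g2)))
    (Num.max (Num.min (dpath f1 g1) (dpath f2 g1))
             (Num.min (dpath f1 g2) (dpath f2 g2))).

(* Only meaningful for [x] in the domain of the pod, that is for
   Psi t^+ <= x < Psi t^c and, if t^c is finite, also for x = Psi t^c. *)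
Definition pod f1 f2 (x : R) : R :=
  if x < Psi (tcoal f1 f2) then f2 (artanh x) - f1 (artanh x) else 0.

(* [line_path y z (factor a b x)] is the value at [x] of the affine function
   equal to [y] at [a] and to [z] at [b].  The value at [x = 1] is only
   meaningful if t^c is finite. *)
Definition std_pod f1 f2 (x : R) : R :=
  let tp := Psi (tplus f1 f2)%:E in
  let tc := Psi (tcoal f1 f2) in
  let tm := (tp + tc) / 2 in
  let l := tm - tp in
  let r := 1 - (tc - tm) in
  let ym := pod f1 f2 tm in
  let ytop := ym + 2^-1 * (1 - (tc - tp)) in
  if x <= l then pod f1 f2 (x + tp)
  else if r <= x then pod f1 f2 (x - (1 - tc))
  else if x <= 2^-1 then line_path ym ytop (factor l 2^-1 x)
  else line_path ytop ym (factor 2^-1 r x).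

Definition Delta (p q : R -> R) : R :=
  \big[+%R/0]_(2 <= n <oo) (2^-1 ^+ n *
    Num.min
      (sup [set `|(p x)^-1 - (q x)^-1| | x in `[n%:R^-1, 1 - n%:R^-1]]) 1).

Definition dtilde (P Q : cpair) : R :=
  dbar P Q + Delta (std_pod (left_path P) (right_path P))
                   (std_pod (left_path Q) (right_path Q)).

End coalescing_pairs.
Arguments cpair R : clear implicits.

(* Main.v *)
Require Import Defs.
From mathcomp Require Import all_boot all_order all_algebra.
From mathcomp Require Import all_classical all_reals all_analysis.
From mathcomp Require Import ring lra.

Set Implicit Arguments.
Unset Strict Implicit.
Unset Printing Implicit Defensive.

Import Order.TTheory GRing.Theory Num.Theory.
Import numFieldNormedType.Exports.

Local Open Scope classical_set_scope.
Local Open Scope ring_scope.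

(** The idea is to replace the labelled standard pod by a formula that does not
    see the labelling.  For paths [f], [g], write [a] and [c] for the images
    under tanh of the starting time of the pair and of its coalescence time, and
    put [l = (c - a) / 2].  On ]0, 1[ the standard pod is
    [|f t - g t| + max 0 (min x (1 - x) - l)], where [t] is the inverse image
    under tanh of [a + min x l + (l - min (1 - x) l)] (lemma [std_pod_gap]).
    This expression is symmetric in [f] and [g], positive on ]0, 1[, and
    continuous jointly in the two paths, [c] and [x] (lemma [gap_cvg]).

    The metric axioms hold because [dtilde] is the Hausdorff distance for the
    metric [dpath] plus a weighted uniform distance between the functions
    [1 / pod], which are bounded on each of the compact sets involved.

    Separability: fix [e > 0].  A pair is coded by one natural number recording,
    up to a small error, its two paths on a long interval and [1 / pod] on a
    compact subinterval of ]0, 1[: a mesh fine enough for the function at hand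
    and rounded values at its points.  Pairs with equal codes are at distance
    less than [e] (lemma [coded_dtilde]), and one representative per code and per
    value [e = 1 / (n + 1)] gives a countable dense set.

    Completeness: left and right paths of a Cauchy sequence of pairs may converge
    only after exchanging labels infinitely often.  An ultrafilter [G] on the
    indices, finer than the eventual filter, makes these choices: along [G] the
    left paths and the right paths are Cauchy and converge to paths [f] and [g]
    (lemma [selection_cvg]), and the transformed coalescence times converge to
    some [c].  By joint continuity the pods converge pointwise to the formula
    above for [f], [g] and [c].  As the functions [1 / pod] form a Cauchy sequence
    they stay bounded on compact sets, so the limit is positive; hence [f] and [g]
    differ at all times after their start whose tanh is below [c].  At times whose
    tanh is above [c] they agree, being limits of paths that agree there.  Thus
    [f] and [g] coalesce, with [c] as the tanh of their coalescence time, infinite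
    if [c = 1] (lemma [tcoal_of_gap]), and the pods converge to the pod of the
    limit pair.  A uniform Cauchy sequence with a pointwise limit converges
    uniformly, which gives convergence in [dtilde] along [G], and a Cauchy
    sequence converges to its limit along any such filter. *)

(** * Weighted uniform distances *)

Section weighted_uniform_distance.
Context {R : realType}.
Implicit Types (A : set R) (K : nat -> set R) (u v w : R -> R).

Definition usup A u v : R := Num.min (sup [set `|u t - v t| | t in A]) 1.

(** The series in [dpath] and the distance [Delta] are both of this form, the
    latter applied to the reciprocals of the pods. *)
Definition wdist (m : nat) K u v : R :=
  \big[+%R/0]_(m <= n <oo) (2^-1 ^+ n * usup (K n) u v).

Definition bounded_on A u : Prop := exists M, forall x, A x -> `|u x| <= M.

Lemma usup_ge0 A u v : 0 <= usup A u v.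
Proof.
rewrite le_min ler01 andbT.
have [[[x Sx] bS]|S0] := pselect (has_sup [set `|u t - v t| | t in A]).
  by apply: le_trans (ub_le_sup bS Sx); case: Sx => t _ <-.
by rewrite sup_out.
Qed.

Lemma usup_le1 A u v : usup A u v <= 1.
Proof. by rewrite ge_min lexx orbT. Qed.

(** Keeping the truncation at 1 inside the hypothesis makes this usable for every
    [e], so that the triangle inequality can be checked pointwise. *)
Lemma usup_le A u v e : 0 <= e ->
  (forall x, A x -> Num.min `|u x - v x| 1 <= e) -> usup A u v <= e.
Proof.
move=> e0 uve; case: (leP 1 e) => [e1|e1].
  exact: le_trans (usup_le1 _ _ _) e1.
rewrite /usup ge_min; apply/orP; left.
have [->|A0] := eqVneq A set0; first by rewrite image_set0 sup0.
apply: ge_sup; first by apply/image_nonempty/set0P.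
move=> _ [t At <-]; have := uve _ At.
by rewrite ge_min => /orP[//|]; rewrite leNgt e1.
Qed.

Lemma le_usup A u v x : bounded_on A u -> bounded_on A v -> A x ->
  Num.min `|u x - v x| 1 <= usup A u v.
Proof.
move=> [M uM] [N vN] Ax; rewrite le_min ge_min ge_min lexx orbT andbT.
apply/orP; left; apply: ub_le_sup; last by exists x.
exists (M + N) => _ [t At <-].
by rewrite (le_trans (ler_normB _ _))// lerD ?uM ?vN.
Qed.

Let term_itv K u v n :
  0 <= (2^-1 : R) ^+ n * usup (K n) u v <= 2^-1 ^+ n.
Proof.
rewrite mulr_ge0 ?usup_ge0 ?exprn_ge0 ?invr_ge0//=.
by rewrite ler_piMr ?usup_le1 ?exprn_ge0 ?invr_ge0.
Qed.

Lemma sum_pow2_le m N : \sum_(m <= n < N) (2^-1 : R) ^+ n <= 2 * 2^-1 ^+ m.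
Proof.
case: (leqP N m) => [Nm|mN]; first by rewrite big_geq// mulr_ge0// exprn_ge0.
suff -> : \sum_(m <= n < N) (2^-1 : R) ^+ n = 2 * 2^-1 ^+ m - 2 * 2^-1 ^+ N.
  by rewrite gerBl mulr_ge0// exprn_ge0.
rewrite -(subnKC (ltnW mN)); elim: (N - m)%N => [|k IH].
  by rewrite addn0 big_geq ?subrr.
by rewrite addnS big_nat_recr ?leq_addr//= IH exprS; field.
Qed.

Section partial_sums.
Variables (m : nat) (K : nat -> set R) (u v : R -> R).
Let S N := \sum_(m <= n < N) 2^-1 ^+ n * usup (K n) u v.

Let S_nd : nondecreasing_seq S.
Proof.
apply/nondecreasing_seqP => n; rewrite /S; case: (leqP m n) => mn.
  by rewrite big_nat_recr//= lerDl; case/andP: (term_itv K u v n).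
by rewrite !big_geq// ltnW.
Qed.

Let S_cvg : cvgn S.
Proof.
apply: nondecreasing_is_cvgn => //; exists (2 * 2^-1 ^+ m) => _ [N _ <-].
apply: le_trans (sum_pow2_le m N); apply: ler_sum => n _.
by case/andP: (term_itv K u v n).
Qed.

Lemma wdist_le e : (forall N, S N <= e) -> wdist m K u v <= e.
Proof. by move=> Se; apply: limr_le => //; apply: nearW. Qed.

Lemma sum_le_wdist N : S N <= wdist m K u v.
Proof. exact: nondecreasing_cvgn_le. Qed.

Lemma usup_le_wdist n : (m <= n)%N ->
  2^-1 ^+ n * usup (K n) u v <= wdist m K u v.
Proof.
move=> mn; apply: le_trans (sum_le_wdist n.+1).
rewrite /S big_nat_recr//= lerDr; apply: sumr_ge0 => i _.
by case/andP: (term_itv K u v i).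
Qed.

Lemma wdist_ge0 : 0 <= wdist m K u v.
Proof. by apply: le_trans (sum_le_wdist m); rewrite /S big_geq. Qed.

(** A single term of the series already dominates the truncated supremum, and the
    truncation is inactive below [e <= 1]. *)
Lemma wdist_lt n e x : (m <= n)%N -> e <= 1 ->
  bounded_on (K n) u -> bounded_on (K n) v -> K n x ->
  wdist m K u v < 2^-1 ^+ n * e -> `|u x - v x| < e.
Proof.
move=> mn e1 bu bv Kx /(le_lt_trans (usup_le_wdist mn)).
rewrite ltr_pM2l ?exprn_gt0// => /(le_lt_trans (le_usup bu bv Kx)).
by rewrite gt_min [1 < e]ltNge e1 orbF.
Qed.

End partial_sums.

Lemma wdist_sym m K u v : wdist m K u v = wdist m K v u.
Proof.
rewrite /wdist; congr (limn _); apply/funext => N; apply: eq_bigr => n _.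
by rewrite /usup; under eq_imagel do rewrite distrC.
Qed.

Lemma wdist_xx m K u : wdist m K u u = 0.
Proof.
apply/eqP; rewrite eq_le wdist_ge0 andbT; apply: wdist_le => N.
apply: sumr_le0 => n _; rewrite mulr_ge0_le0 ?exprn_ge0//.
by apply: usup_le => // x _; rewrite subrr normr0 ge_min lexx.
Qed.

Lemma wdist_triangle m K u v w :
  (forall n, (m <= n)%N -> bounded_on (K n) u) ->
  (forall n, (m <= n)%N -> bounded_on (K n) v) ->
  (forall n, (m <= n)%N -> bounded_on (K n) w) ->
  wdist m K u w <= wdist m K u v + wdist m K v w.
Proof.
move=> bu bv bw; apply: wdist_le => N.
apply: le_trans (lerD (sum_le_wdist m K u v N) (sum_le_wdist m K v w N)).
rewrite -big_split/=; apply: ler_sum_nat => n /andP[mn _].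
rewrite -mulrDr ler_wpM2l ?exprn_ge0//.
apply: usup_le => [|x Kx]; first by rewrite addr_ge0 ?usup_ge0.
apply: le_trans (lerD (le_usup (bu _ mn) (bv _ mn) Kx)
                      (le_usup (bv _ mn) (bw _ mn) Kx)).
have : `|u x - w x| <= `|u x - v x| + `|v x - w x| by exact: ler_distD.
have := normr_ge0 (u x - v x); have := normr_ge0 (v x - w x).
by rewrite !minEle; do 3 case: ifP => ? ; lra.
Qed.

(** As the sets [K n] increase, a bound on [K N] controls all terms up to [N]; the
    geometric tail is small for [N] large.  The constant 8 leaves room for
    geometric sums of size at most 2 in both parts. *)
Lemma wdist_small m K e : 0 < e ->
  (forall n N, (m <= n)%N -> (n <= N)%N -> K n `<=` K N) ->
  exists N, (m <= N)%N /\ forall u v,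
    (forall x, K N x -> `|u x - v x| <= e / 8) -> wdist m K u v < e.
Proof.
move=> e0 Kmono.
have [N0 N0e] : exists N0, forall n, (N0 <= n)%N -> (2^-1 : R) ^+ n < e / 8.
  have /cvgrPdist_lt/(_ (e / 8)) : (fun n => (2^-1 : R) ^+ n) @ \oo --> (0 : R).
    by apply: cvg_expr; rewrite ger0_norm//; lra.
  case; first by rewrite divr_gt0.
  move=> N0 _ H; exists N0 => n /H /=; rewrite sub0r normrN ger0_norm//.
exists (maxn m N0); rewrite leq_maxl; split=> // u v uve.
suff : wdist m K u v <= e / 2 by lra.
apply: wdist_le => N; set P := maxn m N0 in uve *.
have bd n : (m <= n)%N -> 2^-1 ^+ n * usup (K n) u v <=
    2^-1 ^+ n * (e / 8) + (if (n <= P)%N then 0 else 2^-1 ^+ n).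
  move=> mn; case: ifP => nP.
    rewrite addr0 ler_wpM2l ?exprn_ge0//; apply: usup_le; first lra.
    move=> x /(Kmono _ _ mn nP) Kx.
    by rewrite ge_min uve.
  rewrite (le_trans (y := 2^-1 ^+ n))//.
    by case/andP: (term_itv K u v n).
  by rewrite lerDr; apply: mulr_ge0; [exact: exprn_ge0|lra].
apply: (@le_trans _ _ (\sum_(m <= n < N) (2^-1 ^+ n * (e / 8) +
    (if (n <= P)%N then 0 else 2^-1 ^+ n)))).
  by apply: ler_sum_nat => n /andP[mn _]; exact: bd.
rewrite big_split/= -mulr_suml.
have h1 : (\sum_(m <= i < N) 2^-1 ^+ i) * (e / 8) <= 2 * (e / 8).
  rewrite ler_wpM2r//; first lra.
  rewrite (le_trans (sum_pow2_le _ _))// ler_piMr//.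
  by rewrite exprn_ile1//; lra.
have h2 : \sum_(m <= i < N) (if (i <= P)%N then 0 else (2^-1 : R) ^+ i) <=
    2 * (e / 8).
  case: (leqP N P.+1) => NP.
    rewrite big_nat_cond big1 ?mulr_ge0//; first lra.
    by move=> i /andP[/andP[_ iN] _]; rewrite -ltnS (leq_trans iN).
  have mP : (m <= P.+1)%N by rewrite ltnW// ltnS leq_maxl.
  rewrite (big_cat_nat mP (ltnW NP))/= big_nat_cond big1 ?add0r; last first.
    by move=> i /andP[/andP[_ iN] _]; rewrite -ltnS iN.
  apply: (@le_trans _ _ (\sum_(P.+1 <= i < N) 2^-1 ^+ i)).
    by apply: ler_sum => i _; case: ifP => // _; rewrite exprn_ge0.
  rewrite (le_trans (sum_pow2_le _ _))// ler_pM2l//.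
  by apply/ltW/N0e; rewrite leqW// leq_maxr.
lra.
Qed.

End weighted_uniform_distance.

(** * The hyperbolic tangent and its inverse *)

Section hyperbolic_tangent.
Context {R : realType}.
Implicit Types x y : R.

Lemma tanh_itv x : -1 < tanh x < 1.
Proof.
rewrite /tanh; have p := expR_gt0 x; have q := expR_gt0 (- x).
have pq : 0 < expR x + expR (- x) by rewrite addr_gt0.
by rewrite ltr_pdivlMr// ltr_pdivrMr//; apply/andP; split; lra.
Qed.

Lemma artanhK y : -1 < y < 1 -> tanh (artanh y) = y.
Proof.
move=> /andP[y1 y2]; set a := artanh y.
have E2 : expR a * expR a = (1 + y) / (1 - y).
  rewrite -expRD /a /artanh -splitr.
  by rewrite lnK// posrE divr_gt0//; lra.
rewrite /tanh expRN; have p := expR_gt0 a.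
move: (expR a) E2 p => E E2 p.
have -> : (E - E^-1) / (E + E^-1) = (E * E - 1) / (E * E + 1).
  field; rewrite ?gt_eqF//=; nra.
by rewrite E2; field; apply/andP; split; apply/eqP; lra.
Qed.

Lemma ler_artanh y z : -1 < y -> y <= z -> z < 1 -> artanh y <= artanh z.
Proof.
move=> y1 yz z1; rewrite /artanh ler_pM2r ?invr_gt0//.
have a0 : 0 < 1 + y by lra.
have b0 : 0 < 1 - y by lra.
have c0 : 0 < 1 + z by lra.
have d0 : 0 < 1 - z by lra.
rewrite ler_ln ?posrE ?divr_gt0// ler_pdivrMr// mulrAC ler_pdivlMr//.
lra.
Qed.

Lemma ltr_tanh : {mono (@tanh R) : x y / x < y}.
Proof.
apply: leW_mono; apply: le_mono => x y xy; rewrite ltNge; apply/negP => yx.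
have /andP[y1 _] := tanh_itv y; have /andP[_ x1] := tanh_itv x.
by have := ler_artanh y1 yx x1; rewrite !tanhK leNgt xy.
Qed.

Lemma ler_tanh : {mono (@tanh R) : x y / x <= y}.
Proof. by move=> x y; rewrite !leNgt ltr_tanh. Qed.

Lemma tanh0 : tanh 0 = 0 :> R.
Proof. by rewrite /tanh oppr0 subrr mul0r. Qed.

Lemma continuous_tanh : continuous (@tanh R).
Proof.
have cN x : {for x, continuous (fun t : R => expR (- t))}.
  apply: (continuous_comp (f := -%R)); first exact: opp_continuous.
  exact: continuous_expR.
move=> x; apply: cvgM; first by apply: cvgB; [exact: continuous_expR|exact: cN].
apply: cvgV; first by rewrite gt_eqF// addr_gt0// expR_gt0.
by apply: cvgD; [exact: continuous_expR|exact: cN].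
Qed.

Lemma continuous_artanh y : -1 < y < 1 -> {for y, continuous (@artanh R)}.
Proof.
move=> /andP[y1 y2].
have q : {for y, continuous (fun z : R => (1 + z) / (1 - z))}.
  apply: cvgM; first by apply: cvgD; [exact: cvg_cst|exact: cvg_id].
  apply: cvgV; first by rewrite gt_eqF//; lra.
  by apply: cvgB; [exact: cvg_cst|exact: cvg_id].
have l : {for y, continuous (fun z : R => ln ((1 + z) / (1 - z)))}.
  by apply: (continuous_comp q); apply: continuous_ln; rewrite divr_gt0//; lra.
by apply: cvgM; [exact: l|exact: cvg_cst].
Qed.

Lemma le_Psi : {homo (@Psi R) : s t / (s <= t)%E >-> s <= t}.
Proof.
move=> [s| |] [t| |] //=; rewrite ?lexx//.
- by rewrite lee_fin ler_tanh.
- by move=> _; case/andP: (tanh_itv s) => _ /ltW.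
- by move=> _; case/andP: (tanh_itv t) => /ltW.
Qed.

Lemma Psi_le1 (t : \bar R) : Psi t <= 1.
Proof. by rewrite (_ : 1 = Psi (+oo : \bar R)%E)// le_Psi// leey. Qed.

End hyperbolic_tangent.

Section limits_of_min_max.
Context {R : realType} {T : Type} (G : set_system T) {GF : Filter G}.
Implicit Types (u v : T -> R) (a b : R).

Lemma cvg_minr u v a b : u @ G --> a -> v @ G --> b ->
  Num.min (u k) (v k) @[k --> G] --> Num.min a b.
Proof.
move=> ua vb; under eq_fun do rewrite minr_absE; rewrite minr_absE.
apply: cvgM; last exact: cvg_cst.
by apply: cvgB; [exact: cvgD|by apply: cvg_norm; apply: cvgB].
Qed.

Lemma cvg_maxr u v a b : u @ G --> a -> v @ G --> b ->
  Num.max (u k) (v k) @[k --> G] --> Num.max a b.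
Proof.
move=> ua vb; under eq_fun do rewrite maxr_absE; rewrite maxr_absE.
apply: cvgM; last exact: cvg_cst.
by apply: cvgD; [exact: cvgD|by apply: cvg_norm; apply: cvgB].
Qed.

End limits_of_min_max.

(** * Coding continuous functions by natural numbers *)

Section codes.
Context {R : realType}.

Lemma ltr_bound (x : R) : x < (Num.bound x)%:R.
Proof.
have /andP[_] := truncn_itv (normr_ge0 x).
by apply: le_lt_trans; exact: ler_norm.
Qed.

(** For a metric this is equivalent to separability, but unlike a countable dense
    set it passes to subsets and pulls back along maps without any choice of
    nearby points. *)
Definition coded (T : Type) (d : T -> T -> R) : Prop :=
  forall e : R, 0 < e -> exists code : T -> nat,
    forall x y, code x = code y -> d x y < e.

(** Heine-Cantor, obtained from the compactness of the segment in its covering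
    form: near each point some radius works for all nearby centres, and finitely
    many such neighbourhoods cover. *)
Lemma uniform_modulus (a b : R) (u : R -> R) (e : R) : 0 < e ->
  (forall x, x \in `[a, b] -> {for x, continuous u}) ->
  exists d : R, 0 < d /\ forall x y, x \in `[a, b] -> `|y - x| < d ->
    `|u y - u x| < e.
Proof.
move=> e0 uc.
have /compact_near_coveringP/(_ R (0 : R)^'+
    (fun d x => forall y, `|y - x| < d -> `|u y - u x| < e)) :=
  @segment_compact R a b.
case.
  move=> x abx; have /cvgrPdist_lt/(_ (e / 2)) := uc x abx.
  case; first by rewrite divr_gt0.
  move=> /= d d0 H.
  exists (ball x (d / 2), [set r | r < d / 2]) => /=.
    split; first by apply: nbhsx_ballx; rewrite divr_gt0.
    by apply: nbhs_right_lt; rewrite divr_gt0.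
  move=> [x' r] /= [xx' rd] y yx'.
  have h1 := H y; have h2 := H x'.
  move: h1 h2; rewrite /ball/= in xx' *.
  have xx2 : `|x - x'| < d by rewrite (lt_trans xx')//; lra.
  have xy : `|x - y| < d.
    have := ler_distD x' x y; rewrite [`|x' - y|]distrC => h.
    by rewrite (le_lt_trans h)//; lra.
  move=> /(_ xy) h1 /(_ xx2) h2.
  apply: le_lt_trans (ler_distD (u x) (u y) (u x')) _.
  by rewrite [e]splitr; apply: ltrD => //; rewrite distrC.
move=> d0 /= d0p H; exists (d0 / 2); split; first exact: divr_gt0.
move=> x y abx xy; apply: (H (d0 / 2)) => //=.
- by rewrite /ball/= sub0r normrN ger0_norm; lra.
- by rewrite divr_gt0.
Qed.

(** The code consists of a mesh [m] adapted to the function and of the rounded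
    values on the grid of step [1 / (m + 2)].  Equal codes mean the same mesh and
    the same rounded values, so at the grid point just below [x] the two functions
    differ by less than [e / 3], and each varies by less than [e / 3] from there
    to [x]. *)
Lemma coded_continuous (a b e : R) : 0 < e ->
  exists code : (R -> R) -> nat, forall u v : R -> R,
    (forall x, x \in `[a, b] -> {for x, continuous u}) ->
    (forall x, x \in `[a, b] -> {for x, continuous v}) ->
    code u = code v -> forall x, x \in `[a, b] -> `|u x - v x| < e.
Proof.
move=> e0.
pose mesh (u : R -> R) (m : nat) := forall x y, x \in `[a, b] ->
  `|y - x| < m.+1%:R^-1 -> `|u y - u x| < e / 3.
have e3 : 0 < e / 3 by rewrite divr_gt0.
pose code (u : R -> R) : nat :=
  let m := xget 0%N [set m | mesh u m] in
  pickle (m, [seq Num.floor (u (a + j%:R * m.+2%:R^-1) / (e / 3))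
    | j <- iota 0 (Num.bound (b - a) * m.+2).+1]).
exists code => u v uc vc.
have meshP w : (forall x, x \in `[a, b] -> {for x, continuous w}) ->
    mesh w (xget 0%N [set m | mesh w m]).
  move=> /(uniform_modulus e3)[d [d0 dP]].
  pose M := Num.bound d^-1; apply: (@xgetI _ _ [set m | mesh w m] M).
  move=> x y xab yx; apply: dP => //.
  apply: (lt_trans yx); rewrite invf_plt ?posrE//.
  by apply: (lt_trans (ltr_bound d^-1)); rewrite ltr_nat.
move: (meshP u uc) (meshP v vc); rewrite /code.
set m := xget _ [set m | mesh u m]; set m' := xget _ [set m | mesh v m].
move=> mu mv /(pcan_inj pickleK) E; have mm : m = m' := congr1 fst E.
rewrite -mm in mv E; move/(congr1 snd) : E; rewrite [LHS]/snd [RHS]/snd.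
move=> /eq_in_map H x xab.
have /andP[ax xb] : a <= x <= b by move: xab; rewrite in_itv.
pose j := Num.truncn ((x - a) * m.+2%:R).
have y0 : 0 <= (x - a) * m.+2%:R by rewrite mulr_ge0 ?subr_ge0.
have /andP[j1 j2] := truncn_itv y0.
pose y := a + j%:R * m.+2%:R^-1.
have m0 : 0 < m.+2%:R :> R by [].
have yx : `|y - x| < m.+1%:R^-1.
  have -> : y - x = - (x - a - j%:R * m.+2%:R^-1) by rewrite /y; ring.
  rewrite normrN ger0_norm ?subr_ge0 ?ler_pdivrMr//.
  apply: (@lt_le_trans _ _ (m.+2%:R^-1)); last first.
    by rewrite lef_pV2 ?posrE// ler_nat.
  rewrite [X in _ < X](_ : _ = j.+1%:R / m.+2%:R - j%:R / m.+2%:R); last first.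
    by rewrite -mulrBl -[j.+1%:R]natr1 addrAC subrr add0r mul1r.
  by rewrite ltrD2r ltr_pdivlMr.
have /H : j \in iota 0 (Num.bound (b - a) * m.+2).+1.
  rewrite mem_iota/= add0n ltnS -(ler_nat R) (le_trans j1)//.
  rewrite natrM ler_pM2r// (le_trans (lerB xb (lexx a)))//.
  exact/ltW/ltr_bound.
rewrite -/y => fl.
have := mu _ _ xab yx; have := mv _ _ xab yx.
have /andP[u1 u2] := floor_itv (u y / (e / 3)).
have /andP[v1 v2] := floor_itv (v y / (e / 3)).
move: u1 u2 v1 v2; rewrite fl !ler_pdivlMr// !ltr_pdivrMr// intrD.
move: ((Num.floor _)%:~R) => k.
rewrite !ltr_norml => *; apply/andP; lra.
Qed.

End codes.

(** * The metric space of paths *)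

Section paths.
Context {R : realType}.
Implicit Types f g h : rpath R.

Lemma continuous_bounded_on (a b : R) (u : R -> R) :
  (forall x, x \in `[a, b] -> {for x, continuous u}) ->
  bounded_on [set` `[a, b]] u.
Proof.
move=> uc; have uw : {within `[a, b], continuous u}.
  by apply: continuous_in_subspaceT => x /set_mem/= xab; exact: uc.
have := compact_bounded (continuous_compact uw (@segment_compact R a b)).
case=> M [_ /(_ (M + 1))]; rewrite ltrDl => /(_ ltr01) H.
by exists (M + 1) => x xab; apply: H; exists x.
Qed.

(** The stored function is constant before the start, so it is continuous at the
    start from the left as well. *)
Lemma continuous_path f : continuous f.
Proof.
move=> t; have H := @pfun_continuous _ f.
have [tf|tf|->] := ltgtP t (start f).
- rewrite /continuous_at pfun_before ?ltW//; apply: cvg_near_cst.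
  near=> x; rewrite pfun_before// ltW//.
  by near: x; exact: lt_nbhsl.
- move: H => /continuous_within_itvcyP[H _]; apply: H.
  by rewrite in_itv/= andbT.
- move: H => /continuous_within_itvcyP[_ H].
  apply/left_right_continuousP; split; last exact: H.
  by apply: cvg_near_cst; near=> x; rewrite pfun_before// ltW.
Unshelve. all: by end_near. Qed.

Lemma rpath_eq f g : start f = start g -> (forall t, 0 <= t -> f t = g t) ->
  f = g.
Proof.
move=> st fg; have /andP[s0 _] : 0 <= start f <= 1.
  by have := start_itv f; rewrite in_itv.
have fgE : pfun f = pfun g.
  apply/funext => t; case: (leP 0 t) => [/fg//|t0].
  rewrite (@pfun_before _ f) ?(@pfun_before _ g) -?st ?fg//;
  by rewrite (le_trans (ltW t0)).
case: f g st fgE {s0 fg} => s u a b c d [s' u' a' b' c' d']/= ss uu.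
by move: a' b' c' d'; rewrite -ss -uu => *; congr RPath; exact: Prop_irrelevance.
Qed.

Definition window (n : nat) : set R := [set` `[0, n%:R]].

Lemma window_mono n N : (1 <= n)%N -> (n <= N)%N -> window n `<=` window N.
Proof.
move=> _ nN x; rewrite /window/= !in_itv/= => /andP[-> xn]/=.
by rewrite (le_trans xn)// ler_nat.
Qed.

Lemma dpathE f g :
  dpath f g = Num.max `|start f - start g| (wdist 1 window f g).
Proof. by []. Qed.

Lemma bounded_window f n : (1 <= n)%N -> bounded_on (window n) f.
Proof.
by move=> _; apply: continuous_bounded_on => x _; exact: continuous_path.
Qed.

Lemma dpath_ge0 f g : 0 <= dpath f g.
Proof. by rewrite dpathE le_max normr_ge0. Qed.

Lemma dpath_xx f : dpath f f = 0.
Proof. by rewrite dpathE wdist_xx subrr normr0 maxxx. Qed.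

Lemma dpath_sym f g : dpath f g = dpath g f.
Proof. by rewrite !dpathE wdist_sym distrC. Qed.

Lemma dpath_triangle g f h : dpath f h <= dpath f g + dpath g h.
Proof.
rewrite !dpathE ge_max; apply/andP; split.
  apply: le_trans (ler_distD (start g) _ _) _.
  by apply: lerD; rewrite le_max lexx.
apply: le_trans
  (wdist_triangle (bounded_window f) (bounded_window g) (bounded_window h)) _.
by apply: lerD; rewrite le_max lexx orbT.
Qed.

(** Negative times are covered too: a path starts at a nonnegative time and is
    constant before it. *)
Lemma dpath_lt f g n e t : (1 <= n)%N -> e <= 1 ->
  dpath f g < 2^-1 ^+ n * e -> t <= n%:R -> `|f t - g t| < e.
Proof.
move=> n1 e1; rewrite dpathE gt_max => /andP[_ fg].
have key s : 0 <= s -> s <= n%:R -> `|f s - g s| < e.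
  move=> s0 sn; apply: wdist_lt fg => //; try exact: bounded_window.
  by rewrite /window/= in_itv/= s0.
have start0 h : 0 <= start h by have := start_itv h; rewrite in_itv/= => /andP[].
move=> tn; have [/key->//|t0] := leP 0 t.
have const h : h t = h 0 by rewrite !(@pfun_before _ h)// (le_trans (ltW t0)).
by rewrite !const key.
Qed.

Lemma dpath_eq0 f g : dpath f g = 0 -> f = g.
Proof.
move=> fg0; apply: rpath_eq.
  apply/eqP; rewrite -subr_eq0 -normr_le0 -fg0 dpathE le_max lexx//.
move=> t t0; apply/eqP; rewrite -subr_eq0 -normr_le0.
apply/ler_addgt0Pl => e e0; rewrite addr0.
apply: (@le_trans _ _ (Num.min e 1)); last by rewrite ge_min lexx.
apply/ltW/(@dpath_lt _ _ (Num.bound t).+1) => //.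
- by rewrite ge_min lexx orbT.
- by rewrite fg0 mulr_gt0 ?exprn_gt0// lt_min e0 ltr01.
- by apply: le_trans (ltW (ltr_bound t)) _; rewrite ler_nat.
Qed.

Lemma coded_dpath : coded (@dpath R).
Proof.
move=> e e0; have [N [_ NP]] := wdist_small e0 window_mono.
have e8 : 0 < e / 8 by rewrite divr_gt0.
have [c1 c1P] := coded_continuous 0 0 e0.
have [c2 c2P] := coded_continuous 0 N%:R e8.
exists (fun f : rpath R => pickle (c1 (cst (start f)), c2 f)) => f g.
move=> /(pcan_inj pickleK)[E1 E2]; rewrite dpathE gt_max; apply/andP; split.
  apply: (c1P (cst (start f)) (cst (start g)) _ _ E1 0) => [x _|x _|].
  - exact: cst_continuous.
  - exact: cst_continuous.
  - by rewrite in_itv/= lexx.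
apply: NP => x Kx; apply/ltW.
by apply: (c2P f g _ _ E2 x) => // y _; exact: continuous_path.
Qed.

Section convergence.
Variables (T : Type) (G : set_system T).
Context {GP : ProperFilter G}.

(** Uniformity on half-lines that are unbounded to the left is what [dpath] gives,
    and it spares the lower bound on the times at which limits are evaluated. *)
Definition locally_uniform (u : T -> R -> R) (v : R -> R) : Prop :=
  forall (n : nat) e, 0 < e ->
    \forall k \near G, forall s, s <= n%:R -> `|u k s - v s| < e.

Definition path_cvg (u : T -> rpath R) f : Prop :=
  forall e, 0 < e -> \forall k \near G, dpath (u k) f < e.

Lemma path_cvg_unif (u : T -> rpath R) f :
  path_cvg u f -> locally_uniform (fun k => u k) f.
Proof.
move=> uf n e e0; pose e' := Num.min e 1.
have e'0 : 0 < e' by rewrite lt_min e0 ltr01.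
have : 0 < 2^-1 ^+ n.+1 * e' by rewrite mulr_gt0// exprn_gt0.
move=> /uf; apply: filterS => k ukf s sn.
apply: (@lt_le_trans _ _ e'); last by rewrite ge_min lexx.
apply: dpath_lt ukf _ => //; first by rewrite ge_min lexx orbT.
by rewrite (le_trans sn)// ler_nat.
Qed.

Lemma path_cvgP (u : T -> rpath R) f : start (u k) @[k --> G] --> start f ->
  locally_uniform (fun k => u k) f -> path_cvg u f.
Proof.
move=> us uf e e0; have [N [_ NP]] := wdist_small e0 window_mono.
have e8 : 0 < e / 8 by rewrite divr_gt0.
have := uf N _ e8; move/cvgrPdist_lt : us => /(_ _ e0) us u8.
near=> k; rewrite dpathE gt_max; apply/andP; split.
  by rewrite distrC; near: k.
apply: NP => x; rewrite /window/= in_itv/= => /andP[_ xN].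
by apply/ltW; move: x xN; near: k.
Unshelve. all: by end_near. Qed.

(** Locally uniform convergence to a continuous function allows the evaluation
    point to move along the filter.  All limits of starting values and of pods are
    taken with this lemma. *)
Lemma cvg_eval (u : T -> R -> R) v (s : T -> R) s0 :
  locally_uniform u v -> {for s0, continuous v} -> s @ G --> s0 ->
  u k (s k) @[k --> G] --> v s0.
Proof.
move=> uv vc ss; have vs : v (s k) @[k --> G] --> v s0.
  exact: (cvg_comp _ _ ss vc).
apply/cvgrPdist_lt => e e0; have e2 : 0 < e / 2 by rewrite divr_gt0.
move/cvgrPdist_lt : vs => /(_ _ e2) vs.
have su : \forall k \near G, s k <= (Num.bound (s0 + 1))%:R.
  have := cvgr_le _ ss (s0 + 1); rewrite ltrDl => /(_ _ ltr01).
  by apply: filterS => k /le_trans; apply; exact/ltW/ltr_bound.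
have uu := uv (Num.bound (s0 + 1)) _ e2.
near=> k.
have h1 : `|v s0 - v (s k)| < e / 2 by near: k.
have h2 : `|u k (s k) - v (s k)| < e / 2.
  have sk : s k <= (Num.bound (s0 + 1))%:R by near: k.
  by move: sk; move: (s k); near: k.
have := ler_distD (v (s k)) (v s0) (u k (s k)).
by rewrite [`|v (s k) - _|]distrC; lra.
Unshelve. all: by end_near. Qed.

Lemma cvg_path_eval (u : T -> rpath R) f (s : T -> R) s0 :
  path_cvg u f -> s @ G --> s0 -> u k (s k) @[k --> G] --> f s0.
Proof.
move=> /path_cvg_unif uf ss.
exact: (@cvg_eval (fun k => u k) f s s0 uf (@continuous_path f s0) ss).
Qed.

Lemma path_cvg_start (u : T -> rpath R) f :
  path_cvg u f -> start (u k) @[k --> G] --> start f.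
Proof.
move=> uf; apply/cvgrPdist_lt => e /uf; apply: filterS => k.
by rewrite dpathE gt_max distrC => /andP[].
Qed.

Definition cauchy_along (X : Type) (d : X -> X -> R) (u : T -> X) : Prop :=
  forall e, 0 < e -> exists A, G A /\
    forall j k, A j -> A k -> d (u j) (u k) < e.

Lemma real_cauchy_along (u : T -> R) :
  cauchy_along (fun x y => `|x - y|) u -> exists l : R, u @ G --> l.
Proof.
move=> uC; apply/cvg_ex.
apply: (@R_complete _ (u @ G)); apply: cauchy_exP => e /uC[A [GA AP]].
have [j Aj] := filter_ex GA; exists (u j).
have AB : A `<=` u @^-1` ball (u j) e by move=> k Ak; exact: (AP j k Aj Ak).
exact: filterS AB GA.
Qed.

(** The pointwise limits form a function [v] that is a locally uniform limit, hence
    continuous, and the starts converge to some [s0].  That [v] is constant before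
    [s0] follows by passing to the limit in [u k (min t (start (u k))) =
    u k (start (u k))]. *)
Lemma path_complete (u : T -> rpath R) : cauchy_along (@dpath R) u ->
  exists f, path_cvg u f.
Proof.
move=> uC.
have uunif (n : nat) e : 0 < e -> exists A, G A /\
    forall j k, A j -> A k -> forall s, s <= n%:R -> `|u j s - u k s| < e.
  move=> e0; pose e' := Num.min e 1.
  have e'0 : 0 < e' by rewrite lt_min e0 ltr01.
  have : 0 < 2^-1 ^+ n.+1 * e' by rewrite mulr_gt0// exprn_gt0.
  move=> /uC[A [GA AP]]; exists A; split=> // j k Aj Ak s sn.
  apply: (@lt_le_trans _ _ e'); last by rewrite ge_min lexx.
  apply: dpath_lt (AP _ _ Aj Ak) _ => //; first by rewrite ge_min lexx orbT.
  by rewrite (le_trans sn)// ler_nat.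
have /choice[v uv] : forall t, exists l : R, u k t @[k --> G] --> l.
  move=> t; apply: real_cauchy_along => e /(uunif (Num.bound t))[A [GA AP]].
  by exists A; split=> // j k Aj Ak; apply: AP => //; exact/ltW/ltr_bound.
have [s0 us] : exists l : R, start (u k) @[k --> G] --> l.
  apply: real_cauchy_along => e /uC[A [GA AP]]; exists A; split=> // j k Aj Ak.
  by have := AP _ _ Aj Ak; rewrite dpathE gt_max => /andP[].
have vunif : locally_uniform (fun k => u k) v.
  move=> n e e0; have e2 : 0 < e / 2 by rewrite divr_gt0.
  have [A [GA AP]] := uunif n _ e2; apply: filterS (GA) => k Ak s sn.
  suff : `|u k s - v s| <= e / 2 by lra.
  apply: (cvgr_to_le (F := G) (f := fun j => `|u k s - u j s|)).
    by apply: cvg_norm; apply: cvgB; [exact: cvg_cst|exact: uv].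
  by apply: filterS GA => j Aj; apply/ltW/AP.
have vcont : continuous v.
  move=> t; apply/cvgrPdist_lt => e e0; have e3 : 0 < e / 3 by rewrite divr_gt0.
  pose n := Num.bound (t + 1); have tn : t + 1 < n%:R by exact: ltr_bound.
  have [k kP] := filter_ex (vunif n _ e3).
  have := @continuous_path (u k) t => /cvgrPdist_lt/(_ _ e3) uk.
  near=> x.
  have h1 : `|u k t - u k x| < e / 3 by near: x.
  have h2 := kP t; have h3 := kP x.
  have xt : x < t + 1 by near: x; apply: lt_nbhsl; rewrite ltrDl.
  have {}h2 : `|v t - u k t| < e / 3 by rewrite distrC h2//; lra.
  have {}h3 : `|u k x - v x| < e / 3 by rewrite h3//; lra.
  have := ler_distD (u k t) (v t) (v x).
  have := ler_distD (u k x) (u k t) (v x).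
  lra.
have veval s l : s @ G --> l -> u k (s k) @[k --> G] --> v l.
  by move=> sl; exact: (@cvg_eval (fun k => u k) v s l vunif (vcont l) sl).
have s0itv : s0 \in `[0, 1].
  rewrite in_itv/=; apply/andP; split.
    apply: (cvgr_to_ge us); apply: nearW => k.
    by have := start_itv (u k); rewrite in_itv/= => /andP[].
  apply: (cvgr_to_le us); apply: nearW => k.
  by have := start_itv (u k); rewrite in_itv/= => /andP[].
have vs0 : v s0 \in `[-1, 1].
  rewrite in_itv/=; apply/andP; split.
    apply: (cvgr_to_ge (veval _ _ us)); apply: nearW => k.
    by have := pfun_start (u k); rewrite in_itv/= => /andP[].
  apply: (cvgr_to_le (veval _ _ us)); apply: nearW => k.
  by have := pfun_start (u k); rewrite in_itv/= => /andP[].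
have vbefore t : t <= s0 -> v t = v s0.
  move=> ts; have hmin : Num.min t (start (u k)) @[k --> G] --> t.
    have -> : t = Num.min t s0 by rewrite min_l.
    by apply: cvg_minr; [rewrite min_l//; exact: cvg_cst|exact: us].
  apply: (cvg_unique _ (veval _ _ hmin)) => //.
  have -> : (fun k => u k (Num.min t (start (u k)))) =
      (fun k => u k (start (u k))).
    by apply/funext => k; rewrite pfun_before// ge_min lexx orbT.
  exact: veval.
have vwithin : {within `[s0, +oo[, continuous v}.
  exact: continuous_subspaceT.
exists (RPath s0itv vwithin vs0 vbefore).
exact: path_cvgP.
Unshelve. all: by end_near. Qed.

End convergence.

End paths.

(** * The Hausdorff distance between pairs *)

Section hausdorff.
Context {R : realType}.
Implicit Types P Q S : cpair R.

Lemma cset_labelling P : cset P = [set left_path P; right_path P].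
Proof. by rewrite /left_path /right_path /labelling; case: cid => -[f g] []. Qed.

Lemma left_of_labelling P : left_of (left_path P) (right_path P).
Proof. by rewrite /left_path /right_path /labelling; case: cid => -[f g] []. Qed.

(** This form no longer mentions labellings, so the metric axioms and comparisons
    with other enumerations of a pair become immediate. *)
Lemma dbar_leP P Q e : dbar P Q <= e <->
  (forall f, cset P f -> exists g, cset Q g /\ dpath f g <= e) /\
  (forall g, cset Q g -> exists f, cset P f /\ dpath f g <= e).
Proof.
rewrite !cset_labelling /dbar !ge_max !ge_min.
split=> [/andP[/andP[h1 h2] /andP[h3 h4]]|[H1 H2]]; first split.
- by move=> f [->|->]; [case/orP: h1|case/orP: h2] => h;
    eexists; (split; last exact: h); [left|right|left|right].
- by move=> g [->|->]; [case/orP: h3|case/orP: h4] => h;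
    eexists; (split; last exact: h); [left|right|left|right].
- rewrite -!andbA; apply/and4P; split.
  + by have [_ [[->|->] ->]] := H1 _ (or_introl erefl); rewrite ?orbT.
  + by have [_ [[->|->] ->]] := H1 _ (or_intror erefl); rewrite ?orbT.
  + by have [_ [[->|->] ->]] := H2 _ (or_introl erefl); rewrite ?orbT.
  + by have [_ [[->|->] ->]] := H2 _ (or_intror erefl); rewrite ?orbT.
Qed.

Lemma dbar_ge0 P Q : 0 <= dbar P Q.
Proof. by rewrite /dbar !le_max !le_min !dpath_ge0. Qed.

Lemma dbar_le_dpath P Q (f f' g g' : rpath R) e :
  cset P = [set f; f'] -> cset Q = [set g; g'] ->
  dpath f g <= e -> dpath f' g' <= e -> dbar P Q <= e.
Proof.
move=> PE QE fg fg'; apply/dbar_leP; rewrite PE QE; split=> h [->|->].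
- by exists g; split=> //; left.
- by exists g'; split=> //; right.
- by exists f; split=> //; left.
- by exists f'; split=> //; right.
Qed.

Lemma dbar_xx P : dbar P P = 0.
Proof.
apply/eqP; rewrite eq_le dbar_ge0 andbT.
by apply: (dbar_le_dpath (cset_labelling P) (cset_labelling P)); rewrite dpath_xx.
Qed.

Lemma dbar_le_sym P Q : dbar P Q <= dbar Q P.
Proof.
have /dbar_leP[H1 H2] := lexx (dbar Q P); apply/dbar_leP; split=> f /[dup].
  by move=> _ /H2[g [? ?]]; exists g; rewrite dpath_sym.
by move=> _ /H1[g [? ?]]; exists g; rewrite dpath_sym.
Qed.

Lemma dbar_sym P Q : dbar P Q = dbar Q P.
Proof. by apply/eqP; rewrite eq_le !dbar_le_sym. Qed.

Lemma dbar_triangle Q P S : dbar P S <= dbar P Q + dbar Q S.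
Proof.
have /dbar_leP[H1 H2] := lexx (dbar P Q).
have /dbar_leP[K1 K2] := lexx (dbar Q S).
apply/dbar_leP; split.
- move=> f /H1[g [/K1[h [hS gh]] fg]]; exists h; split=> //.
  by apply: (le_trans (dpath_triangle g _ _)); exact: lerD.
- move=> h /K2[g [/H2[f [fP fg]] gh]]; exists f; split=> //.
  by apply: (le_trans (dpath_triangle g _ _)); exact: lerD.
Qed.

Lemma dbar_eq0 P Q : dbar P Q = 0 -> P = Q.
Proof.
move=> PQ0; have /dbar_leP[H1 H2] : dbar P Q <= 0 by rewrite PQ0.
have eq0 (f g : rpath R) : dpath f g <= 0 -> f = g.
  by move=> fg; apply: dpath_eq0; apply/eqP; rewrite eq_le fg dpath_ge0.
have : cset P = cset Q.
  apply/seteqP; split=> f; first by move=> /H1[g [gQ /eq0 ->]].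
  by move=> /H2[g [gP /eq0 <-]].
case: P Q {PQ0 H1 H2} => [A HA] [B HB]/= AB; subst B.
congr CPair; exact: Prop_irrelevance.
Qed.

End hausdorff.

(** * Standard pods as a symmetric, jointly continuous function *)

Section pods.
Context {R : realType}.
Implicit Types (f g : rpath R) (P Q : cpair R) (a c x : R).

Lemma tplus_ge0 f g : 0 <= tplus f g.
Proof.
have := start_itv f; rewrite in_itv/= => /andP[f0 _].
by rewrite /tplus le_max f0.
Qed.

Lemma tplus_sym f g : tplus f g = tplus g f.
Proof. by rewrite /tplus maxC. Qed.

Lemma tcoal_sym f g : tcoal f g = tcoal g f.
Proof.
rewrite /tcoal tplus_sym; congr ereal_inf; congr image.
by apply/seteqP; split=> t /= [].
Qed.

Lemma coalesce_sym f g : coalesce f g -> coalesce g f.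
Proof. by rewrite /coalesce tcoal_sym => -[|H]; [left|right=> t /H]. Qed.

Lemma tplus_le_tcoal f g : ((tplus f g)%:E <= tcoal f g)%E.
Proof. by apply: le_ereal_inf_tmp => _ [t [/ltW tt _] <-]; rewrite lee_fin. Qed.

Lemma lt_tcoal_neq f g t :
  tplus f g < t -> (t%:E < tcoal f g)%E -> f t != g t.
Proof.
move=> tt; rewrite ltNge; apply: contraNneq => fg.
by apply: ereal_inf_lbound; exists t.
Qed.

Lemma coalesce_eq f g t : coalesce f g -> (tcoal f g <= t%:E)%E -> f t = g t.
Proof. by case=> [->|/(_ t)//]; rewrite leye_eq. Qed.

(** With [l = (c - a) / 2] this is [a + x] for [x <= l], the midpoint of [a] and
    [c] for [l <= x <= 1 - l], and [c - (1 - x)] for [1 - l <= x]: the point of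
    the unscaled pod that the standard pod reads at [x]. *)
Definition pod_time a c x : R :=
  let l := (c - a) / 2 in a + Num.min x l + (l - Num.min (1 - x) l).

(** The contribution of the two segments of slope 1 and -1 around [1 / 2]; it
    vanishes outside [l <= x <= 1 - l]. *)
Definition pod_tent a c x : R :=
  Num.max 0 (Num.min x (1 - x) - (c - a) / 2).

(** The argument [c] is kept independent of the pair, because in the proof of
    completeness the limit of the coalescence times is not yet known to be the
    coalescence time of the limit. *)
Definition gap f g c x : R :=
  let a := tanh (tplus f g) in
  let t := artanh (pod_time a c x) in
  `|f t - g t| + pod_tent a c x.

Definition std_gap f g : R -> R := gap f g (Psi (tcoal f g)).

Lemma gap_sym f g c x : gap f g c x = gap g f c x.
Proof. by rewrite /gap tplus_sym distrC. Qed.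

Lemma std_gap_sym f g : std_gap f g = std_gap g f.
Proof. by apply/funext => x; rewrite /std_gap tcoal_sym gap_sym. Qed.

Lemma tanh_tplus_itv f g : 0 <= tanh (tplus f g) < 1.
Proof.
by rewrite -{1}tanh0 ler_tanh tplus_ge0; case/andP: (tanh_itv (tplus f g)).
Qed.

Lemma Psi_tcoal_itv f g : tanh (tplus f g) <= Psi (tcoal f g) <= 1.
Proof. by rewrite Psi_le1 andbT; exact: (le_Psi (tplus_le_tcoal f g)). Qed.

Lemma pod_time_itv a c x : 0 <= a < 1 -> a <= c <= 1 -> 0 < x < 1 ->
  a <= pod_time a c x < 1.
Proof.
move=> /andP[a0 a1] /andP[ac c1] /andP[x0 x1]; rewrite /pod_time !minEle.
by apply/andP; do 2 case: ifP => /idP; split; lra.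
Qed.

Lemma pod_time_left a c x : 0 <= a -> c <= 1 -> x <= (c - a) / 2 ->
  pod_time a c x = a + x.
Proof.
move=> a0 c1 xl; rewrite /pod_time (min_l xl) min_r ?subrr ?addr0//; lra.
Qed.

Lemma pod_time_right a c x : 0 <= a -> c <= 1 -> 1 - x <= (c - a) / 2 ->
  pod_time a c x = c - (1 - x).
Proof.
by move=> a0 c1 xl; rewrite /pod_time (min_l xl) min_r; lra.
Qed.

Lemma pod_time_mid a c x : (c - a) / 2 <= x -> (c - a) / 2 <= 1 - x ->
  pod_time a c x = (a + c) / 2.
Proof. by move=> lx xl; rewrite /pod_time !min_r//; lra. Qed.

Lemma pod_tent0 a c x : (x <= (c - a) / 2) || (1 - x <= (c - a) / 2) ->
  pod_tent a c x = 0.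
Proof.
move=> xl; rewrite /pod_tent max_l// subr_le0 ge_min.
exact: xl.
Qed.

(** Either the tent is positive, or the time read at [x] lies strictly between the
    start of the pair and its coalescence time, where the paths differ. *)
Lemma std_gap_gt0 f g x : 0 < x < 1 -> 0 < std_gap f g x.
Proof.
move=> /andP[x0 x1]; rewrite /std_gap /gap.
have /andP[a0 a1] := tanh_tplus_itv f g.
have /andP[ac c1] := Psi_tcoal_itv f g.
set a := tanh _ in a0 a1 ac *; set c := Psi _ in ac c1 *.
have [lx|xl] := ltP ((c - a) / 2) (Num.min x (1 - x)).
  apply: ltr_wpDl => //; rewrite /pod_tent lt_max subr_gt0.
  by rewrite lx orbT.
set y := pod_time a c x.
suff yac : a < y < c.
  have y1 : -1 < y < 1 by case/andP: yac => *; apply/andP; split; lra.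
  apply: ltr_wpDr; first by rewrite /pod_tent le_max lexx.
  rewrite normr_gt0 subr_eq0; apply: lt_tcoal_neq.
    by rewrite -ltr_tanh artanhK//; case/andP: yac.
  rewrite ltNge; apply/negP => /le_Psi /=; rewrite artanhK// leNgt.
  by case/andP: yac => _ ->.
move: xl; rewrite ge_min => /orP[xl|xl].
  by rewrite /y pod_time_left//; lra.
by rewrite /y pod_time_right//; lra.
Qed.

(** When the pod has length 0 the middle value [pod tm] is 0 by definition, while
    the symmetric formula reads the difference of the paths at the start of the
    pair; this difference vanishes because the paths coalesce there. *)
Lemma std_pod_gap f g x : left_of f g -> coalesce f g -> 0 < x < 1 ->
  std_pod f g x = std_gap f g x.
Proof.
move=> fg cfg /andP[x0 x1]; rewrite /std_pod /std_gap /gap [Psi _%:E]/=.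
have /andP[a0 a1] := tanh_tplus_itv f g.
have /andP[ac c1] := Psi_tcoal_itv f g.
have ca : Psi (tcoal f g) = tanh (tplus f g) -> f (tplus f g) = g (tplus f g).
  move=> ca; apply: coalesce_eq => //.
  case: (tcoal f g) ca => [r| |] /=.
  - by move/eqP; rewrite eq_le ler_tanh => /andP[rt _]; rewrite lee_fin.
  - by move=> E; move: a1; rewrite -E ltxx.
  - by rewrite leNye.
have podE y : tanh (tplus f g) <= y ->
    y < Psi (tcoal f g) \/ y = tanh (tplus f g) ->
    pod f g y = `|f (artanh y) - g (artanh y)|.
  move=> ay yc; rewrite /pod; case: ifP => [_|/negbT].
    rewrite distrC ger0_norm ?subr_ge0//; apply: fg.
    case: yc => [yc|->]; last by rewrite tanhK.
    by rewrite -ler_tanh artanhK//; apply/andP; split; lra.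
  rewrite -leNgt => cy; case: yc => [|yE]; first by rewrite ltNge cy.
  rewrite yE tanhK ca ?subrr ?normr0//.
  by apply/eqP; rewrite eq_le ac -yE cy.
move: (tanh _) (Psi _) a0 a1 ac c1 {ca} podE => a c a0 a1 ac c1 podE.
have -> : (a + c) / 2 - a = (c - a) / 2 by field.
have -> : 1 - (c - (a + c) / 2) = 1 - (c - a) / 2 by field.
case: ifPn => [xl|]; last rewrite -ltNge => lx.
  rewrite pod_tent0 ?xl// addr0 pod_time_left// podE [x + a]addrC//; first lra.
  by left; lra.
case: ifPn => [rx|]; last rewrite -ltNge => xr.
  have xl : 1 - x <= (c - a) / 2 by lra.
  rewrite pod_tent0 ?xl ?orbT// addr0 pod_time_right//.
  have -> : x - (1 - c) = c - (1 - x) by ring.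
  by rewrite podE//; [lra|left; lra].
have lx' : (c - a) / 2 <= 1 - x by lra.
have l2 : (c - a) / 2 - 2^-1 != 0 by apply/eqP; lra.
rewrite pod_time_mid ?(ltW lx)// podE; [|lra|]; last first.
  have [->|ac'] := eqVneq a c; [right; lra|left].
  by have : a < c; [rewrite lt_neqAle ac' ac|lra].
rewrite /line_path /factor /pod_tent.
case: ifPn => [x2|]; last rewrite -ltNge => x2.
  rewrite (min_l (_ : x <= 1 - x)); last lra.
  rewrite max_r; last lra.
  by field; apply/eqP; lra.
rewrite min_r; last lra.
rewrite max_r; last lra.
by field; apply/eqP; lra.
Qed.

Lemma tanh_tplus_cvg (T : Type) (G : set_system T) {GP : ProperFilter G}
    (u v : T -> rpath R) f g : path_cvg G u f -> path_cvg G v g ->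
  tanh (tplus (u k) (v k)) @[k --> G] --> tanh (tplus f g).
Proof.
move=> uf vg; have tp : tplus (u k) (v k) @[k --> G] --> tplus f g.
  by apply: cvg_maxr; exact: path_cvg_start.
exact: (cvg_comp _ _ tp (@continuous_tanh R _)).
Qed.

(** All ingredients of [gap] are continuous: the time [pod_time] stays in ]-1, 1[,
    where [artanh] is continuous, and the paths converge locally uniformly. *)
Lemma gap_cvg (T : Type) (G : set_system T) {GP : ProperFilter G}
    (u v : T -> rpath R) f g (c x : T -> R) c0 x0 :
  path_cvg G u f -> path_cvg G v g -> c @ G --> c0 -> x @ G --> x0 ->
  tanh (tplus f g) <= c0 <= 1 -> 0 < x0 < 1 ->
  gap (u k) (v k) (c k) (x k) @[k --> G] --> gap f g c0 x0.
Proof.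
move=> uf vg cc xx ac x01.
have ta : tanh (tplus (u k) (v k)) @[k --> G] --> tanh (tplus f g).
  exact: tanh_tplus_cvg.
have half : (c k - tanh (tplus (u k) (v k))) / 2 @[k --> G] -->
    (c0 - tanh (tplus f g)) / 2.
  by apply: cvgM; [exact: cvgB|exact: cvg_cst].
have xx1 : 1 - x k @[k --> G] --> 1 - x0 by apply: cvgB => //; exact: cvg_cst.
have tt : artanh (pod_time (tanh (tplus (u k) (v k))) (c k) (x k)) @[k --> G]
    --> artanh (pod_time (tanh (tplus f g)) c0 x0).
  have yy : pod_time (tanh (tplus (u k) (v k))) (c k) (x k) @[k --> G] -->
      pod_time (tanh (tplus f g)) c0 x0.
    by apply: cvgD; [apply: cvgD => //|apply: cvgB => //]; exact: cvg_minr.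
  apply: (cvg_comp _ _ yy); apply: continuous_artanh.
  have /andP[a0 _] := tanh_tplus_itv f g.
  have /andP[ay ->] := pod_time_itv (tanh_tplus_itv f g) ac x01.
  by rewrite andbT; lra.
apply: cvgD.
  by apply: cvg_norm; apply: cvgB; exact: cvg_path_eval.
by apply: cvg_maxr; [exact: cvg_cst|apply: cvgB => //; exact: cvg_minr].
Qed.

Lemma path_cvg_cst (T : Type) (G : set_system T) {GP : ProperFilter G} f :
  path_cvg G (fun=> f) f.
Proof. by move=> e e0; apply: nearW => _; rewrite dpath_xx. Qed.

Lemma continuous_std_gap f g x : 0 < x < 1 ->
  {for x, continuous (std_gap f g)}.
Proof.
move=> x01; rewrite /continuous_at /std_gap.
exact: (@gap_cvg _ (nbhs x) _ (fun=> f) (fun=> g) f g (fun=> Psi (tcoal f g)) id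
  _ x (path_cvg_cst f) (path_cvg_cst g) (cvg_cst _) cvg_id
  (Psi_tcoal_itv f g) x01).
Qed.

End pods.

(** * Completeness and separability in terms of the distance function *)

Section metric_transfer.
Context {R : realType} {T : Type} (d : T -> T -> R) (dm : is_metric d).

Lemma coded_separable : coded d -> separable (metrized dm).
Proof.
move=> cd; have [[x0]|T0] := pselect (inhabited T); last first.
  by exists set0 => // O [x _]; case: T0; constructor.
have /choice[code codeP] : forall n : nat, exists code : T -> nat,
    forall x y, code x = code y -> d x y < n.+1%:R^-1 by move=> n; exact: cd.
pose pick (nk : nat * nat) : metrized dm :=
  xget (x0 : metrized dm) [set x | code nk.1 x = nk.2].
exists (range pick).
  exact/(card_le_trans (card_image_le _ _))/countableP.
move=> O [x Ox] Oo; have /nbhs_ballP[e /= e0 eO] : nbhs x O.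
  exact: open_nbhs_nbhs.
pose n := Num.bound e^-1; exists (pick (n, code n x)).
split; last by exists (n, code n x).
apply: eO; rewrite ballEmdist/=.
have : code n (pick (n, code n x)) = code n x.
  exact: (@xgetI (metrized dm) x0 [set y | code n y = code n x] x erefl).
move=> /esym/codeP/lt_trans; apply.
rewrite invf_plt ?posrE//; apply: (lt_trans (ltr_bound _)).
by rewrite ltr_nat.
Qed.

Lemma cauchy_complete :
  (forall u : nat -> T,
    (forall e, 0 < e -> exists N, forall j k, (N <= j)%N -> (N <= k)%N ->
      d (u j) (u k) < e) ->
    exists x, forall e, 0 < e -> exists N, forall k, (N <= k)%N ->
      d x (u k) < e) ->
  complete_metric (metrized dm).
Proof.
move=> H u /cauchy_ballP uC; have [|x xP] := H u.
  move=> e /uC[[A B] /= [[N1 _ HA] [N2 _ HB]] AB]; exists (maxn N1 N2) => j k.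
  rewrite !geq_max => /andP[j1 j2] /andP[k1 k2].
  have := AB (u j, u k) (conj (HA j j1) (HB k k2)).
  by rewrite /= ballEmdist.
exists x; apply/cvg_ballP => e /xP[N NP].
by exists N => // k /= /NP; rewrite ballEmdist.
Qed.

End metric_transfer.

(** * Metric axioms and separability *)

Section dtilde_metric.
Context {R : realType}.
Implicit Types (f g : rpath R) (P Q : cpair R) (x : R).

Lemma set2_inj (T : Type) (a b c d : T) : [set a; b] = [set c; d] ->
  (a = c /\ b = d) \/ (a = d /\ b = c).
Proof.
move=> E.
have : [set c; d] a by rewrite -E; left.
have : [set c; d] b by rewrite -E; right.
have : [set a; b] c by rewrite E; left.
have : [set a; b] d by rewrite E; right.
by move=> [->|->] [->|->] [|] ? [|] ?; auto.
Qed.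

Definition inv_pod P x : R := (std_pod (left_path P) (right_path P) x)^-1.

Lemma coalesce_labelling P : coalesce (left_path P) (right_path P).
Proof.
have [f [g [+ fg]]] := csetP P; rewrite cset_labelling.
move=> E; have [[-> ->]//|[-> ->]] := set2_inj E; exact: coalesce_sym.
Qed.

(** The formula holds for both enumerations of the pair, since it is symmetric. *)
Lemma inv_podE P f g x : cset P = [set f; g] -> 0 < x < 1 ->
  inv_pod P x = (std_gap f g x)^-1.
Proof.
move=> PE x01; rewrite /inv_pod (std_pod_gap (@left_of_labelling _ P))//.
  rewrite cset_labelling in PE; have [[-> ->]//|[-> ->]] := set2_inj PE.
  by rewrite std_gap_sym.
exact: coalesce_labelling.
Qed.

Definition pod_window (n : nat) : set R := [set` `[n%:R^-1, 1 - n%:R^-1]].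

Lemma pod_window_itv n x : (1 < n)%N -> pod_window n x -> 0 < x < 1.
Proof.
move=> n1; rewrite /pod_window/= in_itv/= => /andP[nx xn].
have n0 : 0 < n%:R^-1 :> R by rewrite invr_gt0 ltr0n ltnW.
by apply/andP; split; lra.
Qed.

Lemma pod_window_mono n N : (2 <= n)%N -> (n <= N)%N ->
  pod_window n `<=` pod_window N.
Proof.
move=> n2 nN x; rewrite /pod_window/= !in_itv/= => /andP[nx xn].
have n0 : (0 < n)%N by exact: ltnW.
have : N%:R^-1 <= n%:R^-1 :> R.
  by rewrite lef_pV2 ?posrE ?ltr0n ?ler_nat// (leq_trans n0).
by move=> Nn; apply/andP; split; lra.
Qed.

Lemma pod_window_cover x : 0 < x < 1 -> exists2 n, (2 <= n)%N & pod_window n x.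
Proof.
move=> /andP[x0 x1]; pose y := Num.min x (1 - x).
have y0 : 0 < y by rewrite lt_min x0 subr_gt0.
pose n := (Num.bound y^-1).+2; exists n => //.
have ny : n%:R^-1 <= y.
  rewrite invf_ple ?posrE ?ltr0n//.
  by apply/ltW/(lt_trans (ltr_bound _)); rewrite ltr_nat /n leqW.
move: ny; rewrite /y le_min => /andP[h1 h2].
by rewrite /pod_window/= in_itv/= h1/=; lra.
Qed.

Lemma continuous_inv_std_gap f g n x : (2 <= n)%N ->
  x \in `[n%:R^-1, 1 - n%:R^-1] ->
  {for x, continuous (fun y => (std_gap f g y)^-1)}.
Proof.
move=> n2 /(pod_window_itv n2) x01; apply: cvgV.
  by rewrite gt_eqF// std_gap_gt0.
exact: continuous_std_gap.
Qed.

Lemma bounded_inv_pod P n : (2 <= n)%N -> bounded_on (pod_window n) (inv_pod P).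
Proof.
move=> n2; have [M MP] := continuous_bounded_on
  (fun x => @continuous_inv_std_gap (left_path P) (right_path P) n x n2).
exists M => x xn; rewrite (inv_podE (cset_labelling P)); first exact: MP.
exact: pod_window_itv xn.
Qed.

Lemma dtildeE P Q :
  dtilde P Q = dbar P Q + wdist 2 pod_window (inv_pod P) (inv_pod Q).
Proof. by []. Qed.

Lemma is_metric_dtilde : is_metric (@dtilde R).
Proof.
split.
- by move=> P Q; rewrite dtildeE addr_ge0 ?dbar_ge0 ?wdist_ge0.
- by move=> P; rewrite dtildeE dbar_xx wdist_xx addr0.
- move=> P Q; rewrite dtildeE => PQ0; apply: dbar_eq0.
  have := dbar_ge0 P Q; have := wdist_ge0 2 pod_window (inv_pod P) (inv_pod Q).
  lra.
- by move=> P Q; rewrite !dtildeE dbar_sym wdist_sym.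
- move=> Q P S; rewrite !dtildeE addrACA; apply: lerD.
    exact: dbar_triangle.
  by apply: wdist_triangle => n n2; exact: bounded_inv_pod.
Qed.

(** Equal codes make both paths and the reciprocals of the pods close, and
    [dtilde] is controlled by these distances. *)
Lemma coded_dtilde : coded (@dtilde R).
Proof.
move=> e e0; have e2 : 0 < e / 2 by rewrite divr_gt0.
have [N [N2 NP]] := wdist_small e2 pod_window_mono.
have e16 : 0 < e / 2 / 8 by rewrite divr_gt0.
have [c1 c1P] := @coded_dpath R _ e2.
have [c2 c2P] := coded_continuous N%:R^-1 (1 - N%:R^-1) e16.
pose ig P x := (std_gap (left_path P) (right_path P) x)^-1.
exists (fun P => pickle (c1 (left_path P), c1 (right_path P), c2 (ig P))).
move=> P Q /(pcan_inj pickleK)[/c1P Pl /c1P Pr Pig].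
rewrite dtildeE [e]splitr; apply: ler_ltD.
  exact: (dbar_le_dpath (cset_labelling P) (cset_labelling Q) (ltW Pl) (ltW Pr)).
apply: NP => x xN; have x01 := pod_window_itv N2 xN.
rewrite !(inv_podE (cset_labelling _) x01); apply/ltW.
apply: (c2P (ig P) (ig Q) _ _ Pig) => //;
  by move=> y yN; apply: continuous_inv_std_gap yN.
Qed.

End dtilde_metric.

(** * Completeness *)

Section completeness.
Context {R : realType}.

(** Positivity of [gap] at the points where the tent vanishes says that the paths
    differ at every time whose tanh lies strictly between [tanh (tplus f g)] and
    [c].  If [c = 1] they never meet after the start; otherwise they meet at all
    times after [artanh c], and at that time by continuity. *)
Lemma tcoal_of_gap (f g : rpath R) c :
  tanh (tplus f g) <= c <= 1 ->
  (forall x, 0 < x < 1 -> 0 < gap f g c x) ->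
  (forall t, c < tanh t -> f t = g t) ->
  Psi (tcoal f g) = c /\ coalesce f g.
Proof.
move=> /andP[ac c1] gap0 fgc; have /andP[a0 a1] := tanh_tplus_itv f g.
have neq t : tplus f g < t -> tanh t < c -> f t != g t.
  rewrite -ltr_tanh => at_ tc.
  have [tm|mt] := leP (tanh t) ((tanh (tplus f g) + c) / 2).
    have xl : tanh t - tanh (tplus f g) <= (c - tanh (tplus f g)) / 2 by lra.
    have := gap0 (tanh t - tanh (tplus f g)); rewrite /gap.
    rewrite pod_tent0 ?xl// pod_time_left//.
    rewrite subrKC tanhK addr0 normr_gt0 subr_eq0; apply.
    by apply/andP; split; lra.
  have xr : 1 - (1 - (c - tanh t)) <= (c - tanh (tplus f g)) / 2 by lra.
  have := gap0 (1 - (c - tanh t)); rewrite /gap.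
  rewrite pod_tent0 ?xr ?orbT// pod_time_right//.
  rewrite subKr subKr tanhK addr0 normr_gt0 subr_eq0; apply.
  by apply/andP; split; lra.
have [c1E|cn1] := eqVneq c 1.
  suff E : tcoal f g = +oo%E by rewrite /coalesce E c1E; split=> //; left.
  rewrite /tcoal (_ : [set t | _] = set0) ?image_set0 ?ereal_inf0//.
  apply/seteqP; split=> t //= [/neq + fg].
  rewrite c1E; have /andP[_ ->] := tanh_itv t; move=> /(_ isT).
  by rewrite fg eqxx.
have {}c1 : c < 1 by rewrite lt_neqAle cn1.
have cE : tanh (artanh c) = c by rewrite artanhK// c1 andbT; lra.
have cT : tplus f g <= artanh c by rewrite -ler_tanh cE.
have fg_gt t : artanh c < t -> f t = g t by rewrite -ltr_tanh cE; exact: fgc.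
have tE : tcoal f g = (artanh c)%:E.
  apply/eqP; rewrite eq_le; apply/andP; split.
    apply/lee_addgt0Pr => e e0; apply: ereal_inf_lbound.
    exists (artanh c + e) => //; split; first by rewrite (le_lt_trans cT)// ltrDl.
    by apply: fg_gt; rewrite ltrDl.
  apply: le_ereal_inf_tmp => _ [t [tt fg] <-]; rewrite lee_fin leNgt.
  apply/negP; rewrite -ltr_tanh cE => /(neq _ tt).
  by rewrite fg eqxx.
split; first by rewrite tE /= cE.
right=> t; rewrite tE lee_fin le_eqVlt => /orP[/eqP <-|/fg_gt//].
have h1 : f t @[t --> (artanh c)^'+] --> f (artanh c).
  exact/cvg_at_right_filter/continuous_path.
have h2 : g t @[t --> (artanh c)^'+] --> g (artanh c).
  exact/cvg_at_right_filter/continuous_path.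
apply: (cvg_unique _ h1) => //.
apply: cvg_trans h2; apply: near_eq_cvg; near=> s; rewrite fg_gt//.
Unshelve. all: by end_near. Qed.

Section cauchy_sequence.
Variable P : nat -> cpair R.
Hypothesis PC : forall e, 0 < e -> exists N, forall j k,
  (N <= j)%N -> (N <= k)%N -> dtilde (P j) (P k) < e.
Variable G : set_system nat.
Hypotheses (GU : UltraFilter G) (Goo : \oo `<=` G).
Let GP : ProperFilter G := ultra_proper.

Let G_ge N : G [set k | (N <= k)%N].
Proof. by apply: Goo; exact: nbhs_infty_ge. Qed.

Let dbar_le_dtilde Q S : dbar Q S <= dtilde Q S :> R.
Proof. by rewrite dtildeE lerDl wdist_ge0. Qed.

Let wdist_le_dtilde Q S :
  wdist 2 pod_window (inv_pod Q) (inv_pod S) <= dtilde Q S :> R.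
Proof. by rewrite dtildeE lerDr dbar_ge0. Qed.

(** For [k >= N], the path [s k] is close to one of the two paths of [P N].  The
    ultrafilter decides which of the two alternatives holds on a large set of
    indices, and on this set the [s k] are close to each other. *)
Lemma selection_cvg (s : nat -> rpath R) : (forall k, cset (P k) (s k)) ->
  exists f, path_cvg G s f.
Proof.
move=> sP; apply: path_complete => e e0.
have e2 : 0 < e / 2 by rewrite divr_gt0.
have [N NP] := PC e2.
have close k : (N <= k)%N -> exists h, cset (P N) h /\ dpath (s k) h < e / 2.
  move=> Nk; have /dbar_leP[/(_ _ (sP k))[h [hP sh]] _] := lexx (dbar (P k) (P N)).
  exists h; split=> //; apply: (le_lt_trans sh).
  by apply: (le_lt_trans (dbar_le_dtilde _ _)); exact: NP.
have tri h j k : dpath (s j) h < e / 2 -> dpath (s k) h < e / 2 ->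
    dpath (s j) (s k) < e.
  move=> jh kh; apply: (le_lt_trans (dpath_triangle h _ _)).
  by rewrite [e]splitr; apply: ltrD => //; rewrite dpath_sym.
have [GB|GB] :=
  in_ultra_setVsetC [set k | dpath (s k) (left_path (P N)) < e / 2] GU.
  by eexists; split; [exact: GB|move=> j k; exact: tri].
eexists; split; first exact: filterI GB (G_ge N).
have right k : ~ dpath (s k) (left_path (P N)) < e / 2 -> (N <= k)%N ->
    dpath (s k) (right_path (P N)) < e / 2.
  by move=> nl /close[h []]; rewrite cset_labelling => -[->|->].
by move=> j k [nj Nj] [nk Nk]; apply: tri (right _ nj Nj) (right _ nk Nk).
Qed.

Lemma bounded_ultra_cvg (c : nat -> R) (a b : R) :
  (forall k, a <= c k <= b) -> exists l : R, c @ G --> l.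
Proof.
move=> cab; have := @segment_compact R a b (c @ G).
case; first by apply: nearW => k /=; rewrite in_itv/= cab.
move=> l [_ lcl]; exists l => B lB.
have [//|GB] := in_ultra_setVsetC (c @^-1` B) GU.
by have [x []] := lcl (~` B) B GB lB.
Qed.

(** The limit pair is made of the limits of the left and of the right paths.  The
    tail of the sequence of reciprocals of pods is uniformly Cauchy on each window,
    which first bounds the pods away from 0 and finally turns pointwise
    convergence into uniform convergence. *)
Lemma cauchy_pairs_cvg : exists Q : cpair R,
  forall e, 0 < e -> \forall k \near G, dtilde Q (P k) < e.
Proof.
pose u k := left_path (P k); pose v k := right_path (P k).
have [f uf] : exists f, path_cvg G u f.
  by apply: selection_cvg => k; rewrite cset_labelling; left.
have [g vg] : exists g, path_cvg G v g.
  by apply: selection_cvg => k; rewrite cset_labelling; right.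
pose c k := Psi (tcoal (u k) (v k)).
have cP k : 0 <= c k <= 1.
  have /andP[a0 _] := tanh_tplus_itv (u k) (v k).
  have /andP[ac ->] := Psi_tcoal_itv (u k) (v k).
  by rewrite (le_trans a0 ac).
have [c0 cc] := bounded_ultra_cvg cP.
have c01 : tanh (tplus f g) <= c0 <= 1.
  apply/andP; split; last first.
    by apply: (cvgr_to_le cc); apply: nearW => k; case/andP: (cP k).
  apply: (ler_cvg_to (tanh_tplus_cvg uf vg) cc); apply: nearW => k.
  by case/andP: (Psi_tcoal_itv (u k) (v k)).
have gapc x : 0 < x < 1 -> std_gap (u k) (v k) x @[k --> G] --> gap f g c0 x.
  by move=> x01; exact: (gap_cvg uf vg cc (cvg_cst x) c01 x01).
have podE k x : 0 < x < 1 -> inv_pod (P k) x = (std_gap (u k) (v k) x)^-1.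
  by apply: inv_podE; exact: cset_labelling.
have unif n e : (2 <= n)%N -> 0 < e -> e <= 1 -> exists N, forall j k x,
    (N <= j)%N -> (N <= k)%N -> pod_window n x ->
    `|inv_pod (P j) x - inv_pod (P k) x| < e.
  move=> n2 e0 e1; have : 0 < (2^-1 : R) ^+ n * e by rewrite mulr_gt0// exprn_gt0.
  move=> /PC[N NP]; exists N => j k x Nj Nk xn.
  apply: (wdist_lt n2 e1 _ _ xn); try exact: bounded_inv_pod.
  by apply: (le_lt_trans (wdist_le_dtilde _ _)); exact: NP.
have gap_gt0 x : 0 < x < 1 -> 0 < gap f g c0 x.
  (* A bound [M] for the reciprocals bounds the pods, and their limit, below. *)
  move=> x01; have [n n2 xn] := pod_window_cover x01.
  have [N NP] := unif n 1 n2 ltr01 (lexx 1).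
  pose M := inv_pod (P N) x + 1.
  have M0 : 0 < M by rewrite ltr_wpDl// podE// invr_ge0 ltW// std_gap_gt0.
  apply: (@lt_le_trans _ _ M^-1); first by rewrite invr_gt0.
  apply: (cvgr_to_ge (gapc x x01)); apply: filterS (G_ge N) => k Nk.
  have := NP k N x Nk (leqnn N) xn; rewrite ltr_norml => /andP[_].
  have gk0 : 0 < std_gap (u k) (v k) x by exact: std_gap_gt0.
  rewrite ltrBlDl -/M podE// => /ltW; rewrite invf_ple ?posrE//.
have fgc t : c0 < tanh t -> f t = g t.
  (* Eventually the coalescence time of the pair of index [k] is at most [t]. *)
  move=> ct; have ut : u k t @[k --> G] --> f t.
    exact: (cvg_path_eval uf (cvg_cst t)).
  have vt : v k t @[k --> G] --> g t by exact: (cvg_path_eval vg (cvg_cst t)).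
  apply: (cvg_unique _ ut) => //; apply: cvg_trans vt; apply: near_eq_cvg.
  have cltt : \forall k \near G, c k < tanh t by apply: cvgr_lt cc _ ct.
  apply: filterS cltt => k ck.
  apply: esym; apply: coalesce_eq (coalesce_labelling (P k)) _.
  rewrite leNgt; apply/negP => /ltW/le_Psi/=; rewrite -/(c k).
  by rewrite leNgt ck.
have [tcE cfg] := tcoal_of_gap c01 gap_gt0 fgc.
pose Q := CPair (ex_intro _ f (ex_intro _ g (conj erefl cfg))).
have QE : cset Q = [set f; g] by [].
exists Q => e e0; have e2 : 0 < e / 2 by rewrite divr_gt0.
have [N [N2 NP]] := wdist_small e2 pod_window_mono.
pose e' := Num.min 1 (e / 2 / 8).
have e'0 : 0 < e' by rewrite lt_min ltr01 divr_gt0.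
have e'1 : e' <= 1 by rewrite ge_min lexx.
have [K KP] := unif N e' N2 e'0 e'1.
have uf2 := uf _ e2; have vg2 := vg _ e2; have GK := G_ge K.
near=> k.
rewrite dtildeE [e]splitr; apply: ler_ltD.
  apply: (dbar_le_dpath QE (cset_labelling (P k))); rewrite dpath_sym; apply/ltW.
    by near: k.
  by near: k.
apply: NP => x xN; have x01 := pod_window_itv N2 xN.
apply: (@le_trans _ _ e'); last by rewrite ge_min lexx orbT.
rewrite (inv_podE QE x01) /std_gap tcE.
have Kk : (K <= k)%N by near: k.
apply: (cvgr_to_le (F := G) (f := fun j => `|inv_pod (P j) x - inv_pod (P k) x|)).
  apply: cvg_norm; apply: cvgB; last exact: cvg_cst.
  under eq_fun do rewrite podE//.
  by apply: cvgV; [rewrite gt_eqF// gap_gt0|exact: gapc].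
by apply: filterS (G_ge K) => j Kj; apply/ltW/KP.
Unshelve. all: by end_near. Qed.

End cauchy_sequence.

Lemma dtilde_complete (P : nat -> cpair R) :
  (forall e, 0 < e -> exists N, forall j k,
    (N <= j)%N -> (N <= k)%N -> dtilde (P j) (P k) < e) ->
  exists Q, forall e, 0 < e -> exists N, forall k, (N <= k)%N ->
    dtilde Q (P k) < e.
Proof.
move=> PC; have [G [GU Goo]] := ultraFilterLemma eventually_filter.
have [Q QP] := cauchy_pairs_cvg PC GU Goo; exists Q => e e0.
have e2 : 0 < e / 2 by rewrite divr_gt0.
have [N NP] := PC _ e2; exists N => k Nk.
have GP : ProperFilter G := ultra_proper.
have GN : G [set j | (N <= j)%N] by apply: Goo; exact: nbhs_infty_ge.
have [j [Qj Nj]] := filter_ex (filterI (QP _ e2) GN).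
apply: (le_lt_trans (is_metric_triangle (@is_metric_dtilde R) (P j) _ _)).
rewrite [e]splitr; exact: ltrD Qj (NP j k Nj Nk).
Qed.

End completeness.

Theorem mainTheorem1 (R : realType) :
  exists dm : is_metric (@dtilde R),
    complete_metric (metrized dm) /\ separable (metrized dm).
Proof.
exists (@is_metric_dtilde R); split.
  by apply: cauchy_complete => P; exact: dtilde_complete.
exact/coded_separable/coded_dtilde.
Qed.
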